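(* For the Hawkes processes started empty at time $0$ with kernel shape $g(t)=\gamma(1+t)^{-1-\gamma}$, $\gamma\in(1/2,1)$, baseline $\mu_T=\mu^*T^{\gamma-1}$ and branching ratio $\rho_T=1-\lambda^*T^{-\gamma}$, the observed information $$Q_T=\mu_T^2\int_0^T\frac{\mathrm dt}{\lambda_T(t)}$$ satisfies $Q_T\to\infty$ in probability as $T\to\infty$.
   Context: Fix $\lambda^*,\mu^*>0$; $T$ is large enough that $\rho_T\in(0,1)$. $N$ is the linear Hawkes process started empty at time $0$: a simple point process on $(0,\infty)$ with stochastic intensity $\lambda_T(t)=\mu_T+\rho_T\int_{(0,t)}g(t-s)\,N(\mathrm ds)$. *)

(* Defs.v *)
From HB Require Import structures.
From mathcomp Require Import all_boot all_order all_algebra.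
From mathcomp Require Import all_classical all_reals all_analysis measurable_realfun.

Set Implicit Arguments.
Unset Strict Implicit.
Unset Printing Implicit Defensive.

Import Order.TTheory GRing.Theory Num.Theory.
Import numFieldNormedType.Exports.

Local Open Scope classical_set_scope.
Local Open Scope ring_scope.

(* A (non-explosive) simple point process on (0, +oo), given by its ordered
   points.  The value +oo means that there is no n-th point, so that finite
   configurations are allowed. *)
Record point_process d (Omega : measurableType d) (R : realType) := PointProcess {
  point : nat -> Omega -> \bar R ;
  measurable_point : forall n, measurable_fun [set: Omega] (point n) ;
  point_gt0 : forall n w, (0 < point n w)%E ;
  point_lt : forall n w, (point n w < +oo)%E -> (point n w < point n.+1 w)%E ;
  cvg_point : forall w, point n w @[n --> \oo] --> +oo%E }.

Section counting_measure.
Context d (Omega : measurableType d) (R : realType).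
Variable N : point_process Omega R.

Definition point_mass (w : Omega) (n : nat) : {measure set R -> \bar R} :=
  if point N n w is r%:E then dirac r else mzero.

(* N(w, ds), the sum of the Dirac masses at the finite points *)
Definition point_measure (w : Omega) : {measure set R -> \bar R} :=
  mseries (point_mass w) 0.

End counting_measure.

Record filtration d (Omega : measurableType d) (R : realType) := Filtration {
  filt : R -> set (set Omega) ;
  sigma_algebra_filt : forall t, 0 <= t -> sigma_algebra setT (filt t) ;
  filt_measurable : forall t, 0 <= t -> filt t `<=` measurable ;
  le_filt : forall s t, 0 <= s -> s <= t -> filt s `<=` filt t }.

Section stochastic_intensity.
Context d (Omega : measurableType d) (R : realType).
Variables (P : probability Omega R) (F : filtration Omega R).
Variable N : point_process Omega R.

Definition adapted_point_process :=
  forall t : R, 0 <= t ->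
    measurable_fun (setT : set (g_sigma_algebraType (filt F t)))
      (fun w => point_measure N w `]0, t]%classic).

Definition predictable_rectangles : set (set (R * Omega)) :=
  [set D | exists s t A, [/\ 0 <= s, s <= t, filt F s A &
    D = `]s, t]%classic `*` A]].

(* Only the restriction of C to (0, +oo) * Omega matters: off that set the
   measurability condition forces C to be constant. *)
Definition predictable (C : R * Omega -> R) :=
  measurable_fun (setT : set (g_sigma_algebraType predictable_rectangles)) C.

(* lambda is the F-intensity of N: it is nonnegative, predictable and locally
   integrable, and E int C dN = E int C lambda dt for all predictable C >= 0. *)
Definition stochastic_intensity (lambda : R -> Omega -> R) :=
  [/\ adapted_point_process,
      forall t w, 0 <= lambda t w,
      predictable (fun x => if 0 < x.1 then lambda x.1 x.2 else 0),
      {ae P, forall w, forall t, 0 <= t ->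
        (\int[lebesgue_measure]_(s in `]0%R, t]) (lambda s w)%:E < +oo)%E} &
      forall C : R * Omega -> R, predictable C -> (forall x, 0 <= C x) ->
        (\int[P]_w \int[point_measure N w]_(s in `]0%R, +oo[) (C (s, w))%:E =
         \int[P]_w \int[lebesgue_measure]_(s in `]0%R, +oo[)
           (C (s, w) * lambda s w)%:E)%E].

End stochastic_intensity.

Section hawkes.
Context d (Omega : measurableType d) (R : realType).

Definition hawkes_intensity (mu rho : R) (g : R -> R)
    (N : point_process Omega R) (t : R) (w : Omega) : R :=
  mu + rho * \int[point_measure N w]_(s in `]0, t[) g (t - s).

Definition hawkes_process (P : probability Omega R) (mu rho : R) (g : R -> R)
    (N : point_process Omega R) :=
  exists F : filtration Omega R,
    stochastic_intensity P F N (hawkes_intensity mu rho g N).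

Definition observed_information (mu rho : R) (g : R -> R)
    (N : point_process Omega R) (T : R) (w : Omega) : \bar R :=
  ((mu ^+ 2)%:E * \int[lebesgue_measure]_(t in `[0%R, T])
     ((hawkes_intensity mu rho g N t w)^-1)%:E)%E.

End hawkes.

Section parameters.
Context (R : realType).

Definition kernel_shape (gamma t : R) : R :=
  gamma * (1 + t) `^ (- 1 - gamma).

Definition baseline (mus gamma T : R) : R := mus * T `^ (gamma - 1).

Definition branching_ratio (lambdas gamma T : R) : R :=
  1 - lambdas * T `^ (- gamma).

End parameters.

(* Main.v *)
Require Import Defs.
From mathcomp Require Import all_boot all_order all_algebra.
From mathcomp Require Import all_classical all_reals all_analysis measurable_realfun.
From mathcomp Require Import ring lra.

Set Implicit Arguments.
Unset Strict Implicit.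
Unset Printing Implicit Defensive.

Import Order.TTheory GRing.Theory Num.Theory.
Import numFieldNormedType.Exports.

Local Open Scope classical_set_scope.
Local Open Scope ring_scope.

(** Why the information diverges.

    Fix a horizon and write mu for the baseline, N(b) for the number of points
    in (0, b] and L(b) for the integral of the intensity over (0, b].  The
    kernel has mass at most 1 and the branching ratio is at most 1, so that
    L(b) <= mu b + N(b) (integral_hawkes_intensity_le).

    By the inequality between arithmetic and harmonic means
    (integral_inv_ge), the window (b/2, b] contributes at least
    mu^2 (b/2)^2 / L(b) to the observed information.  This is bounded below as
    soon as N(b) is at most a constant times (mu b)^2.  The latter is the
    typical size of N(b): about mu b immigrants arrive before time b, each has
    a Galton-Watson family that is at most critical, and the sum of n
    independent critical family sizes, whose tails decay like x^(-1/2), is of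
    order n^2.  The bound P(N(b) >= C (mu b)^2) <= 2 delta, with C of order
    delta^(-2), holds uniformly over b, mu and the branching ratio.

    Each dyadic scale b = 2^j / mu, j <= J, therefore contributes at least a
    constant eta, except with probability 2 delta.  By Markov's inequality at
    least half of the scales contribute, except with probability 4 delta,
    whatever the dependence between scales (information_large).  The scales
    below the horizon T are those with 2^j <= mu T, and mu_T T = mu^* T^gamma
    tends to infinity, so J can be taken arbitrarily large.

    The tail bound on N(b) (jumps_tail) comes from the exponential weight
    Z_s = (1 - c)^(N(s)) exp(c L(s)) with c = delta / (mu b).  Between points
    Z grows at rate c Z times the intensity, and at a point it drops by c Z
    (by less than m c Z if m > 1 points coincide), so that E Z >= 1 by the
    defining identity of the intensity applied to the left limits of Z.
    Together with L <= mu b + N this gives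
    1 <= exp(c mu b) E q^(N(b)) with q = (1 - c) exp(c), and q <= 1 - c^2 / 4:
    the first-order terms cancel and the quadratic remainder makes q^(N(b))
    small when N(b) is large compared with c^(-2). *)

(** * Integration against the point measure *)

Lemma integral_point_measure d (Omega : measurableType d) (R : realType)
    (N : point_process Omega R) (w : Omega) (D : set R) (f : R -> \bar R) :
  measurable D -> measurable_fun D f -> (forall x, D x -> (0 <= f x)%E) ->
  (\int[point_measure N w]_(x in D) f x =
   \sum_(0 <= n <oo)
     if Defs.point N n w is r%:E then (if r \in D then f r else 0) else 0)%E.
Proof.
move=> mD mf f0; rewrite ge0_integral_measure_series//.
apply: eq_eseriesr => n _; rewrite /point_mass; case: (Defs.point N n w) => [r||].
- rewrite integral_dirac// diracE; case: (r \in D) => /=.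
  + by rewrite mul1e.
  + by rewrite mul0e.
- by rewrite integral_measure_zero.
- by rewrite integral_measure_zero.
Qed.

(** Points tend to infinity, so only finitely many of them precede a level. *)
Lemma point_gt_near d (Omega : measurableType d) (R : realType)
    (N : point_process Omega R) (w : Omega) (b : R) :
  exists M, forall n, (M <= n)%N -> (b%:E < Defs.point N n w)%E.
Proof.
have /cvgeyPgt/(_ b)[M _ HM] := cvg_point N w.
by exists M => n Mn; apply: HM.
Qed.

(** The enumeration of the points is constrained only after a finite value: an
    infinite one may be followed by smaller or repeated points.  Sorting the
    finitely many points up to [b] gives an enumeration in time order, with
    multiplicities, that still computes integrals. *)
Lemma jumps_exist d (Omega : measurableType d) (R : realType)
    (N : point_process Omega R) (b : R) (w : Omega) :
  exists s : seq R, [/\ sorted <=%R s, all (fun x => 0 < x <= b) s &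
    forall (D : set R) (f : R -> \bar R), measurable D -> measurable_fun D f ->
      (forall x, D x -> (0 <= f x)%E) ->
      (forall x, D x -> ~~ (0 < x <= b) -> f x = 0%E) ->
      (\int[point_measure N w]_(x in D) f x = \sum_(x <- s | x \in D) f x)%E].
Proof.
have [M HM] := point_gt_near N w b.
pose s := [seq fine (Defs.point N n w) | n <- iota 0 M & (Defs.point N n w <= b%:E)%E].
exists (sort <=%R s); split.
- exact: (sort_sorted (@le_total _ R)).
- rewrite all_sort; apply/allP => x /mapP[n]; rewrite mem_filter => /andP[nb _] ->.
  have := point_gt0 N n w; move: nb; case: (Defs.point N n w) => [r||]//=.
  by rewrite lee_fin lte_fin => -> ->.
move=> D f mD mf f0 fb; rewrite integral_point_measure//.
rewrite (perm_big _ (permEl (perm_sort _ _)))/= big_map big_filter_cond.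
rewrite (nneseries_split 0 M); last first.
  by move=> k _; case: (Defs.point N k w) => // r; case: ifPn => //; rewrite inE => /f0.
rewrite add0n [X in (_ + X)%E]eseries0 ?adde0; last first.
  move=> n Mn _; have := HM _ Mn; case: (Defs.point N n w) => // r.
  rewrite lte_fin => br; case: ifPn => //; rewrite inE => /fb ->//.
  by rewrite negb_and -!ltNge orbC br.
rewrite /index_iota subn0 [RHS]big_mkcond/=; apply: eq_bigr => n _.
case E : (Defs.point N n w) => [r||]//=.
- have r0 : 0 < r by have := point_gt0 N n w; rewrite E lte_fin.
  rewrite lee_fin; case: ifPn => rD; last by rewrite andbF.
  rewrite andbT; case: ifPn => // rb.
  by apply: fb; [rewrite inE in rD|rewrite r0].
- by have := point_gt0 N n w; rewrite E.
Qed.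

(** * The exponential weight along a path *)

Lemma integral_derive (R : realType) (F f : R -> R) (a b : R) : a <= b ->
  (forall x, a <= x <= b -> is_derive x 1 F (f x)) ->
  (forall x, a <= x <= b -> {for x, continuous f}) ->
  (\int[lebesgue_measure]_(x in `]a, b]) (f x)%:E = (F b - F a)%:E)%E.
Proof.
move=> ab dF cf.
have cfw : {within `[a, b], continuous f}.
  apply: continuous_in_subspaceT => x; rewrite inE/= in_itv/= => xab.
  exact: cf.
have cF x : a <= x <= b -> {for x, continuous F}.
  move=> /dF xab; apply: differentiable_continuous.
  by apply/derivable1_diffP; exact: ex_derive.
have mf : measurable_fun `]a, b] (EFin \o f).
  apply/measurable_EFinP; apply: (@measurable_funS _ _ _ _ `[a, b]) => //.
    by apply: subset_itvr; rewrite bnd_simp.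
  exact: subspace_continuous_measurable_fun.
move: ab; rewrite le_eqVlt => /predU1P[<-|ab].
  by rewrite set_itvoc0 integral_set0 subrr.
rewrite integral_itv_obnd_cbnd; last first.
  exact: mf.
rewrite (@continuous_FTC2 _ f F)//.
- split.
  + move=> x; rewrite in_itv/= => /andP[ax xb].
    by apply: ex_derive; apply: dF; rewrite !ltW.
  + by apply: cvg_at_right_filter; apply: cF; rewrite lexx ltW.
  + by apply: cvg_at_left_filter; apply: cF; rewrite lexx ltW.
- move=> x; rewrite in_itv/= => /andP[ax xb].
  rewrite derive1E; have := dF x; rewrite !ltW// => /(_ isT) h.
  exact: derive_val.
Qed.

(** The primitive [G] is part of the data so that the compensator of a
    configuration is the explicit finite sum of [G] over elapsed times; the
    last bound on [G] says that the kernel has mass at most one. *)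
Record subprobability_kernel (R : realType) (g G : R -> R) : Prop := {
  kernel_ge0 : forall u : R, 0 <= u -> 0 <= g u ;
  kernel_continuous : forall u : R, 0 <= u -> {for u, continuous g} ;
  kernel_is_derive : forall u : R, 0 <= u -> is_derive u 1 G (g u) ;
  kernel_primitive0 : G 0 = 0 ;
  kernel_primitive_le1 : forall u : R, 0 <= u -> G u <= 1 ;
  measurable_kernel : measurable_fun setT g ;
  measurable_kernel_primitive : measurable_fun setT G }.

(** A deterministic path: [t] is the nondecreasing sequence of points in
    (0, b], padded with [b] from index [m] on, and the path is observed up to
    its [k]-th point. *)
Section exponential_path.
Context (R : realType).
Variables (mu rho c b : R) (g G : R -> R) (t : nat -> R) (m k : nat).
Hypotheses (c_ge0 : 0 < c) (c_le1 : c <= 1) (mu_ge0 : 0 <= mu) (rho_ge0 : 0 <= rho).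
Hypothesis gG : subprobability_kernel g G.
Hypothesis t_gt0 : forall j, 0 < t j.
Hypothesis t_le : forall j, t j <= b.
Hypothesis t_homo : {homo t : i j / (i <= j)%N >-> i <= j}.
Hypothesis t_last : forall j, (m <= j)%N -> t j = b.

Definition path_intensity (s : R) : R :=
  mu + rho * \sum_(0 <= j < k) (if t j < s then g (s - t j) else 0).

(** Left limit at [s] of (1 - c) to the number of points, times the
    exponential of [c] times the compensator. *)
Definition path_weight (s : R) : R :=
  \prod_(0 <= j < k) (if t j < s then 1 - c else 1) *
  expR (c * (mu * s + rho * \sum_(0 <= j < k) (if t j < s then G (s - t j) else 0))).

(* [p n] is the left end of the n-th interval between points, [l n] the
   compensator on that interval continued beyond it, and [W n] the weight just
   after the n-th point. *)
Let p n := if n is n'.+1 then t n' else 0.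
Let l n x := mu * x + rho * \sum_(0 <= j < n) G (x - t j).
Let W n := \prod_(0 <= j < n) (if (j < m)%N then 1 - c else 1) * expR (c * l n (p n)).

Let big_truncate (idx : R) (op : Monoid.law idx) (F : nat -> R) n s :
  (n < k)%N -> s <= t n ->
  \big[op/idx]_(0 <= j < k) (if t j < s then F j else idx) =
  \big[op/idx]_(0 <= j < n) (if t j < s then F j else idx).
Proof.
move=> nk st; rewrite (big_cat_nat (n := n))//=; last exact: ltnW.
rewrite [X in op _ X]big_nat_cond [X in op _ X]big1 ?Monoid.mulm1//.
move=> j /andP[/andP[nj _] _].
by rewrite ltNge (le_trans st)// t_homo.
Qed.

Let big_prefix (idx : R) (op : Monoid.law idx) (F : nat -> R) n s :
  (n < k)%N -> p n < s <= t n ->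
  \big[op/idx]_(0 <= j < k) (if t j < s then F j else idx) =
  \big[op/idx]_(0 <= j < n) F j.
Proof.
move=> nk /andP[ps st]; rewrite (big_truncate _ _ nk)//.
rewrite big_nat_cond [RHS]big_nat_cond; apply: eq_bigr => j /andP[/andP[_ +] _].
case: n ps {st nk} => // n ps; rewrite ltnS => jn.
by rewrite (le_lt_trans _ ps)// t_homo.
Qed.

Let p_ge0 n : 0 <= p n.
Proof. by case: n => //= n; rewrite ltW. Qed.

Let p_le n : p n <= t n.
Proof. by case: n => [|n] /=; [rewrite ltW|rewrite t_homo]. Qed.

(** Several points at the same time: the left limit only sees the points
    strictly before, hence misses factors 1 - c and is larger. *)
Let W_le_weight n : (n < m)%N -> (n < k)%N -> p n = t n -> W n <= path_weight (t n).
Proof.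
move=> nm nk pt; rewrite /path_weight.
rewrite (big_truncate _ (fun=> 1 - c) nk)// (big_truncate _ (fun j => G (t n - t j)) nk)//.
rewrite /W /l pt; apply: ler_pM.
- by apply: prodr_ge0 => j _; case: ifP; rewrite ?subr_ge0.
- exact: expR_ge0.
- rewrite big_nat_cond [leRHS]big_nat_cond; apply: ler_prod => j /andP[/andP[_ jn] _].
  rewrite (ltn_trans jn nm) subr_ge0 c_le1/=.
  by case: ifP => // _; rewrite gerBl ltW.
- rewrite ler_expR ler_wpM2l ?(ltW c_ge0)// lerD2l ler_wpM2l//.
  apply: ler_sum_nat => j /andP[_ jn]; case: ifPn => //.
  by rewrite -leNgt => tn; rewrite (_ : t n - t j = 0) ?(kernel_primitive0 gG)//;
    apply/eqP; rewrite subr_eq0 eq_le tn t_homo// ltnW.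
Qed.

Let dl n x := mu + rho * \sum_(0 <= j < n) g (x - t j).

Let l_is_derive n x : (forall j, (j < n)%N -> t j <= x) -> is_derive x 1 (l n) (dl n x).
Proof.
move=> tx.
have dS : is_derive x 1 (fun y => \sum_(0 <= j < n) G (y - t j))
    (\sum_(0 <= j < n) g (x - t j)).
  elim: n tx => [_|n IH tx].
    rewrite big_nil.
    rewrite (_ : (fun y => _) = cst 0); last by apply/funext => y; rewrite big_nil.
    exact: is_derive_cst.
  rewrite big_nat_recr//=.
  rewrite (_ : (fun y => _) = (fun y => \sum_(0 <= j < n) G (y - t j)) +
      (G \o (fun y => y - t n))); last first.
    by apply/funext => y; rewrite big_nat_recr.
  apply: is_deriveD; first by apply: IH => j jn; apply: tx; rewrite ltnW.
  rewrite -[g _]mulr1; apply: is_derive1_comp.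
    by apply: (kernel_is_derive gG); rewrite subr_ge0 tx.
  by rewrite -[X in is_derive _ _ _ X]subr0; exact: is_deriveB.
rewrite (_ : l n = (mu \*: id) + (rho \*: (fun y => \sum_(0 <= j < n) G (y - t j))))//.
rewrite (_ : dl n x = mu *: 1 + rho *: \sum_(0 <= j < n) g (x - t j)); last first.
  by rewrite /dl /GRing.scale/= mulr1.
exact: is_deriveD.
Qed.

Let dl_continuous n x : (forall j, (j < n)%N -> t j <= x) -> {for x, continuous (dl n)}.
Proof.
move=> tx; apply: cvgD; first exact: cvg_cst.
apply: cvgMr => /=.
elim: n tx => [_|n IH tx].
  rewrite (_ : (fun y => _) = cst 0); last by apply/funext => y; rewrite big_nil.
  rewrite big_nil; exact: cvg_cst.
rewrite (_ : (fun y => _) = (fun y => \sum_(0 <= j < n) g (y - t j) + g (y - t n))); last first.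
  by apply/funext => y; rewrite big_nat_recr.
rewrite big_nat_recr//=; apply: cvgD; first by apply: IH => j jn; apply: tx; rewrite ltnW.
apply: (@continuous_comp _ _ _ (fun y => y - t n) g).
  by apply: cvgB => //; exact: cvg_cst.
by apply: (kernel_continuous gG); rewrite subr_ge0 tx.
Qed.

Let weightE n s : (n < k)%N -> p n < s <= t n ->
  path_weight s = (1 - c) ^+ n * expR (c * l n s).
Proof.
move=> nk ps; rewrite /path_weight.
rewrite (@big_prefix _ _ (fun=> 1 - c) n)// (@big_prefix _ _ (fun j => G (s - t j)) n)//.
by rewrite prodr_const_nat subn0.
Qed.

Lemma path_intensity_ge0 s : 0 <= path_intensity s.
Proof.
rewrite addr_ge0// mulr_ge0//; apply: sumr_ge0 => j _; case: ifP => // ts.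
by rewrite (kernel_ge0 gG)// subr_ge0 ltW.
Qed.

Lemma path_weight_ge0 s : 0 <= path_weight s.
Proof.
rewrite mulr_ge0 ?expR_ge0//; apply: prodr_ge0 => j _.
by case: ifP => // _; rewrite subr_ge0.
Qed.

Let measurable_intensity : measurable_fun setT path_intensity.
Proof.
apply: measurable_funD => //; apply: measurable_funM => //.
apply: measurable_sum => j; apply: measurable_fun_ifT => //.
  exact: measurable_fun_ltr.
by apply: measurableT_comp (measurable_kernel gG) _; exact: measurable_funB.
Qed.

Let measurable_weight : measurable_fun setT path_weight.
Proof.
apply: measurable_funM.
  apply: measurable_prod => j _; apply: measurable_fun_ifT => //.
  exact: measurable_fun_ltr.
apply: measurableT_comp => //; apply: measurable_funM => //; apply: measurable_funD.
  exact: measurable_funM.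
apply: measurable_funM => //.
apply: measurable_sum => j; apply: measurable_fun_ifT => //.
  exact: measurable_fun_ltr.
by apply: measurableT_comp (measurable_kernel_primitive gG) _; exact: measurable_funB.
Qed.

(** On an interval without points the weight is, up to a constant, the
    exponential of [c] times the compensator, whose derivative is the
    intensity. *)
Let integral_step n : (n < k)%N ->
  (\int[lebesgue_measure]_(s in `]p n, t n]) (path_weight s * path_intensity s)%:E =
  (c^-1 * (1 - c) ^+ n * (expR (c * l n (t n)) - expR (c * l n (p n))))%:E)%E.
Proof.
move=> nk.
have tp x j : p n <= x -> (j < n)%N -> t j <= x.
  case: n {nk} => // n px; rewrite ltnS => jn.
  by apply: le_trans px; exact: t_homo.
transitivity (\int[lebesgue_measure]_(s in `]p n, t n])
    ((1 - c) ^+ n * expR (c * l n s) * dl n s)%:E)%E.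
  apply: eq_integral => s; rewrite inE/= in_itv/= => ps; congr EFin.
  rewrite (weightE nk)//; congr (_ * _); rewrite /path_intensity.
  by rewrite (@big_prefix _ _ (fun j => g (s - t j)) n).
pose F s := c^-1 * (1 - c) ^+ n * expR (c * l n s).
have dF x : p n <= x <= t n -> is_derive x 1 F ((1 - c) ^+ n * expR (c * l n x) * dl n x).
  move=> /andP[px _].
  have dE : is_derive x 1 (expR \o (c \*: l n)) (expR (c * l n x) * (c *: dl n x)).
    apply: is_derive1_comp; apply: is_deriveZ; apply: l_is_derive => j; exact: tp.
  apply: (is_derive_eq (is_deriveZ (c^-1 * (1 - c) ^+ n) dE)).
  by rewrite /GRing.scale/=; field; rewrite gt_eqF.
rewrite (@integral_derive R F _ (p n) (t n) (p_le n) dF); first by rewrite /F mulrBr.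
move=> x /andP[px _].
have cl : {for x, continuous (l n)}.
  apply: differentiable_continuous; apply/derivable1_diffP.
  have := @l_is_derive n x (fun j => @tp x j px) => ?; exact: ex_derive.
apply: cvgM.
  apply: cvgMr; apply: continuous_cvg; first exact: continuous_expR.
  by apply: cvgMr; exact: cl.
by apply: dl_continuous => j; exact: tp.
Qed.

Let exponential_path_prefix n : (n <= k)%N -> exists I : R,
  (\int[lebesgue_measure]_(s in `]0%R, p n]) (path_weight s * path_intensity s)%:E = I%:E)%E /\
  1 + c * I <= W n + c * \sum_(0 <= j < n) (if (j < m)%N then path_weight (t j) else 0).
Proof.
elim: n => [_|n IH nk].
  exists 0; rewrite set_itvoc0 integral_set0; split=> //.
  by rewrite /W /l !big_nil /= !mulr0 !addr0 mulr0 expR0 mulr1.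
have [I [IE IW]] := IH (ltnW nk).
exists (I + c^-1 * (1 - c) ^+ n * (expR (c * l n (t n)) - expR (c * l n (p n)))).
have mZ : measurable_fun `]0, t n] (fun s => (path_weight s * path_intensity s)%:E).
  by apply/measurable_EFinP/measurable_funTS; apply: measurable_funM.
split.
  rewrite /= (@itv_bndbnd_setU _ _ _ (BRight (p n)))//; last 2 first.
  - by rewrite bnd_simp.
  - by rewrite bnd_simp.
  rewrite ge0_integral_setU//.
  - by rewrite IE integral_step.
  - by rewrite -itv_bndbnd_setU ?bnd_simp.
  - move=> s _; by rewrite lee_fin mulr_ge0 ?path_weight_ge0 ?path_intensity_ge0.
  - apply/disj_setPS => x [/=]; rewrite !in_itv/= => /andP[_ xp] /andP[].
    by rewrite ltNge xp.
rewrite big_nat_recr//=.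
set S := \sum_(0 <= j < n) _ in IW *.
have -> : 1 + c * (I + c^-1 * (1 - c) ^+ n * (expR (c * l n (t n)) - expR (c * l n (p n)))) =
  1 + c * I + (1 - c) ^+ n * (expR (c * l n (t n)) - expR (c * l n (p n))).
  by field; rewrite gt_eqF.
have WS : W n.+1 = (if (n < m)%N then 1 - c else 1) *
    (\prod_(0 <= j < n) (if (j < m)%N then 1 - c else 1) * expR (c * l n (t n))).
  rewrite /W /= big_nat_recr//= /l big_nat_recr//= subrr (kernel_primitive0 gG) addr0.
  by rewrite mulrCA mulrA.
rewrite WS.
have [pt|pt] := eqVneq (p n) (t n).
  rewrite pt subrr mulr0 addr0 (le_trans IW)// -pt -/(W n).
  case: ifPn => nm; last lra.
  have := ler_wpM2l (ltW c_ge0) (W_le_weight nm nk pt); rewrite -pt; lra.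
have {}pt : p n < t n by rewrite lt_neqAle pt p_le.
have jm j : (j < n)%N -> (j < m)%N.
  move=> jn; rewrite ltnNge; apply/negP => /t_last tb.
  have : t j <= p n by case: (n) jn => // n'; rewrite ltnS => jn; exact: t_homo.
  by rewrite tb leNgt (lt_le_trans pt).
have -> : \prod_(0 <= j < n) (if (j < m)%N then 1 - c else 1) = (1 - c) ^+ n.
  rewrite -[in RHS](subn0 n) -prodr_const_nat big_nat_cond [RHS]big_nat_cond.
  by apply: eq_bigr => j /andP[/andP[_ /jm ->]].
have WE : W n = (1 - c) ^+ n * expR (c * l n (p n)).
  congr (_ * _); rewrite -[in RHS](subn0 n) -prodr_const_nat big_nat_cond [RHS]big_nat_cond.
  by apply: eq_bigr => j /andP[/andP[_ /jm ->]].
move: IW; rewrite WE (weightE nk) ?pt ?lexx//.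
case: ifP => _; lra.
Qed.

(** Pathwise form of the martingale property.  The weight gains [c] times the
    integral of weight times intensity between points, and loses [c] times its
    left limit at an isolated point.  It is only an inequality because of
    points that coincide, where charging the common left limit for each of
    them overestimates the loss. *)
Lemma exponential_path : exists I : R,
  (\int[lebesgue_measure]_(s in `]0%R, p k]) (path_weight s * path_intensity s)%:E = I%:E)%E /\
  1 + c * I <= W k + c * \sum_(0 <= j < k) (if (j < m)%N then path_weight (t j) else 0).
Proof. exact: exponential_path_prefix. Qed.

End exponential_path.

(** * Points in time order, stopping times and predictability *)

Section jumps.
Context d (Omega : measurableType d) (R : realType).
Variables (N : point_process Omega R) (b : R).
Hypothesis b_gt0 : 0 < b.

Definition jumps (w : Omega) : seq R := sval (cid (jumps_exist N b w)).

(** The default value [b] makes this the minimum of [b] and the j-th smallest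
    point, hence a bounded stopping time even if there are few points. *)
Definition jump_time (j : nat) (w : Omega) : R := nth b (jumps w) j.

Lemma jumps_sorted w : sorted <=%R (jumps w).
Proof. by have [] := svalP (cid (jumps_exist N b w)). Qed.

Lemma jumps_itv w x : x \in jumps w -> 0 < x <= b.
Proof. by have [_ /allP + _] := svalP (cid (jumps_exist N b w)); apply. Qed.

Lemma integral_jumps w (D : set R) (f : R -> \bar R) :
  measurable D -> measurable_fun D f -> (forall x, D x -> (0 <= f x)%E) ->
  (forall x, D x -> ~~ (0 < x <= b) -> f x = 0%E) ->
  (\int[point_measure N w]_(x in D) f x = \sum_(x <- jumps w | x \in D) f x)%E.
Proof. by have [_ _] := svalP (cid (jumps_exist N b w)); apply. Qed.

Lemma jump_time_gt0 j w : 0 < jump_time j w.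
Proof.
rewrite /jump_time; have [js|js] := ltnP j (size (jumps w)).
  by have /jumps_itv/andP[] := mem_nth b js.
by rewrite nth_default.
Qed.

Lemma jump_time_le j w : jump_time j w <= b.
Proof.
rewrite /jump_time; have [js|js] := ltnP j (size (jumps w)).
  by have /jumps_itv/andP[] := mem_nth b js.
by rewrite nth_default.
Qed.

Lemma jump_time_default j w : (size (jumps w) <= j)%N -> jump_time j w = b.
Proof. by move=> js; rewrite /jump_time nth_default. Qed.

Lemma jump_time_homo w : {homo jump_time ^~ w : i j / (i <= j)%N >-> i <= j}.
Proof.
move=> i j ij; have [js|js] := ltnP j (size (jumps w)).
  apply: (sorted_leq_nth le_trans lexx) => //; first exact: jumps_sorted.
  exact: leq_ltn_trans ij js.
by rewrite (jump_time_default js) jump_time_le.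
Qed.

Lemma point_measure_count w t : 0 <= t <= b ->
  point_measure N w `]0, t]%classic = (count (<= t) (jumps w))%:R%:E.
Proof.
move=> /andP[t0 tb].
rewrite -[LHS]mul1e -integral_cst//= integral_jumps//; last first.
  by move=> x; rewrite /= in_itv/= => /andP[-> /le_trans /(_ tb) ->].
rewrite sumEFin big_const_seq iter_addr_0.
congr (_%:R%:E); apply: eq_in_count => x /jumps_itv/andP[x0 _].
by apply/idP/idP; rewrite /= inE/= in_itv/= x0.
Qed.

(** A time order is determined by counts, so that adaptedness of the counting
    process alone makes the ordered points stopping times. *)
Lemma jump_time_leE w t j : t < b ->
  (jump_time j w <= t) = (j < count (<= t) (jumps w))%N.
Proof.
move=> tb; apply/idP/idP => [jt|]; last exact: nth_count_le (jumps_sorted w).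
rewrite ltnNge; apply/negP => cj; move: jt; apply/negP; rewrite -ltNge.
have [js|js] := ltnP j (size (jumps w)); last by rewrite jump_time_default.
by apply: nth_count_gt (jumps_sorted w) _; rewrite cj.
Qed.

End jumps.

Section stopping.
Context d (Omega : measurableType d) (R : realType).
Variables (F : filtration Omega R) (N : point_process Omega R).

Definition stopping_time (tau : Omega -> R) :=
  forall t, 0 <= t -> filt F t [set w | tau w <= t].

Lemma count_filt t n : adapted_point_process F N -> 0 <= t ->
  filt F t [set w | (n%:R%:E <= point_measure N w `]0%R, t]%classic)%E].
Proof.
move=> adN t0; have mN := adN _ t0.
have := emeasurable_fun_c_infty measurableT mN n%:R%:E.
rewrite setTI => h.
have : (<<s filt F t >>) [set w | (n%:R%:E <= point_measure N w `]0%R, t]%classic)%E].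
  exact: h.
by rewrite sigma_algebra_id//; exact: sigma_algebra_filt.
Qed.

Lemma stopping_jump_time b j : 0 < b -> adapted_point_process F N ->
  stopping_time (jump_time N b j).
Proof.
move=> b0 adN t t0; have [bt|tb] := leP b t.
  rewrite (_ : [set w | _] = setT); last first.
    by apply/seteqP; split => // w _ /=; exact: le_trans (jump_time_le _ _ _ _) bt.
  have [F0 FC _] := sigma_algebra_filt F t0.
  by rewrite -(setD0 setT); exact: FC.
rewrite (_ : [set w | _] = [set w | ((j.+1)%:R%:E <= point_measure N w `]0%R, t]%classic)%E]).
  exact: count_filt.
apply/funext => w /=; rewrite (@point_measure_count _ _ _ _ b)//; last first.
  by rewrite t0 ltW.
by rewrite jump_time_leE// lee_fin ler_nat.
Qed.

Local Notation PT := (g_sigma_algebraType (predictable_rectangles F)).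

(** Separate the stopping time from the current time by a rational [q]: the
    set is a countable union of rectangles that start at [q] over the event
    that [tau] has occurred by time [q]. *)
Lemma measurable_after tau r : (forall w, 0 <= tau w) -> stopping_time tau ->
  measurable ([set x | tau x.2 < x.1 /\ tau x.2 <= r] : set PT).
Proof.
move=> tau0 st; have [r0|r0] := ltP r 0.
  rewrite (_ : [set x | _] = set0)//; apply/seteqP; split => // x /= [_].
  by rewrite leNgt (lt_le_trans r0).
rewrite (_ : [set x | _] = \bigcup_(q : rat) \bigcup_(n : nat)
    (if 0 <= ratr q :> R then
     `]ratr q, ratr q + n%:R]%classic `*` [set w | tau w <= Num.min (ratr q) r]
     else set0)); last first.
  apply/seteqP; split.
    move=> [s w]/= [ts tr].
    have [q] := rat_in_itvoo ts; rewrite in_itv/= => /andP[tq qs].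
    (* the number n only serves to make the rectangle bounded *)
    exists q => //; exists (Num.truncn (s - ratr q)).+1 => //.
    rewrite (le_trans (tau0 w) (ltW tq)); split => /=.
      rewrite in_itv/= qs/= -lerBlDl.
      exact/ltW/truncnS_gt.
    by rewrite le_min ltW.
  move=> [s w] [q _] [n _]; case: ifP => // q0 [/=]; rewrite in_itv/= le_min.
  by move=> /andP[qs _] /andP[tq tr]; split=> //; exact: le_lt_trans qs.
apply: bigcupT_measurable_rat => q; apply: bigcupT_measurable => n.
case: ifPn => // q0; apply: sub_sigma_algebra.
exists (ratr q), (ratr q + n%:R), [set w | tau w <= Num.min (ratr q) r]; split => //.
- by rewrite lerDl.
- have q1 : 0 <= Num.min (ratr q) r by rewrite le_min q0.
  by apply: (le_filt q1 _ (st _ q1)); rewrite ge_min lexx.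
Qed.

Lemma measurable_fun_after tau : (forall w, 0 <= tau w) -> stopping_time tau ->
  measurable_fun (setT : set PT) (fun x : PT => tau x.2 < x.1).
Proof.
move=> tau0 st; apply: (measurable_fun_bool true).
rewrite setTI (_ : _ @^-1` _ = \bigcup_n [set x : PT | tau x.2 < x.1 /\ tau x.2 <= n%:R]).
  by apply: bigcupT_measurable => n; exact: measurable_after.
apply/seteqP; split => [x /= tx|x [n _] []//].
exists (Num.truncn (tau x.2)).+1 => //; split=> //.
exact/ltW/truncnS_gt.
Qed.

Lemma measurable_fun_after_time tau : (forall w, 0 <= tau w) -> stopping_time tau ->
  measurable_fun (setT : set PT) (fun x : PT => if tau x.2 < x.1 then tau x.2 else 0).
Proof.
move=> tau0 st mT; apply: (measurability _ (RGenOInfty.measurableE R)) => //.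
move=> /= _ [_ [r ->] <-]; rewrite setTI.
have [r0|r0] := ltP r 0.
  rewrite (_ : _ @^-1` _ = setT)//; apply/seteqP; split => // x _ /=.
  by rewrite in_itv/= andbT; case: ifP => // _; rewrite (lt_le_trans r0).
rewrite (_ : _ @^-1` _ = [set x : PT | tau x.2 < x.1] `\`
    [set x : PT | tau x.2 < x.1 /\ tau x.2 <= r]).
  apply: measurableD; last exact: measurable_after.
  by have := measurable_fun_after tau0 st mT (I : measurable [set true]); rewrite setTI; exact.
apply/seteqP; split => x /=; rewrite in_itv/= andbT.
  case: ifPn => [tx rt|_]; last by rewrite ltNge r0.
  by split => // -[_]; rewrite leNgt rt.
by move=> [tx]; rewrite tx => /not_andP[//|/negP]; rewrite -ltNge.
Qed.

Lemma stopping_cst r : 0 <= r -> stopping_time (cst r).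
Proof.
move=> r0 t t0; have [F0 FC _] := sigma_algebra_filt F t0; have [rt|tr] := leP r t.
  rewrite (_ : [set w | _] = setT); last by apply/seteqP; split.
  by rewrite -(setD0 setT); exact: FC.
rewrite (_ : [set w | _] = set0); last first.
  by apply/seteqP; split => // w /=; rewrite leNgt tr.
exact: F0.
Qed.

Lemma measurable_fun_time :
  measurable_fun (setT : set PT) (fun x : PT => if 0 < x.1 then x.1 else 0).
Proof.
move=> mT; apply: (measurability _ (RGenOInfty.measurableE R)) => //.
move=> /= _ [_ [r ->] <-]; rewrite setTI.
have [r0|r0] := ltP r 0.
  rewrite (_ : _ @^-1` _ = setT)//; apply/seteqP; split => // x _ /=.
  by rewrite in_itv/= andbT; case: ifP => // x0; rewrite (lt_trans r0).
rewrite (_ : _ @^-1` _ = [set x : PT | cst r x.2 < x.1]).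
  have := measurable_fun_after (fun=> r0) (stopping_cst r0) mT (I : measurable [set true]).
  by rewrite setTI; exact.
apply/seteqP; split => x /=; rewrite in_itv/= andbT; case: ifPn => // x0.
  by rewrite ltNge r0.
by move=> /(le_lt_trans r0); rewrite (negbTE x0).
Qed.

Lemma predictable_measurable (C : R * Omega -> R) :
  predictable F C -> measurable_fun setT C.
Proof.
move=> pC _ B mB; have := pC measurableT B mB; rewrite !setTI.
apply: smallest_sub; first exact: sigma_algebra_measurable.
move=> _ [s [t [A [s0 st FA ->]]]]; apply: measurableX => //.
exact: filt_measurable FA.
Qed.

End stopping.

(** * Tail of the number of points *)

(** The integral of a nonnegative function is a supremum over simple functions
    below it, hence monotone even for functions that are not known to be
    measurable, such as the point integral of the weight as a function of the
    outcome. *)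
Lemma ge0_le_integralT d (T : measurableType d) (R : realType)
    (mu : {measure set T -> \bar R}) (f1 f2 : T -> \bar R) :
  (forall x, (0 <= f1 x)%E) -> (forall x, (f1 x <= f2 x)%E) ->
  (\int[mu]_x f1 x <= \int[mu]_x f2 x)%E.
Proof.
move=> f10 f12; have f20 x : (0 <= f2 x)%E by exact: le_trans (f10 x) (f12 x).
rewrite !ge0_integralTE//; apply: ereal_sup_le => x [h /= hf hx].
by exists h => //= z; exact: le_trans (hf z) (f12 z).
Qed.

Lemma sum_nat_eq_support (R : nmodType) (F : nat -> R) n1 n2 :
  (forall j, (n1 <= j)%N -> F j = 0) -> (forall j, (n2 <= j)%N -> F j = 0) ->
  \sum_(0 <= j < n1) F j = \sum_(0 <= j < n2) F j.
Proof.
wlog n12 : n1 n2 / (n1 <= n2)%N => [hw F1 F2|F1 _].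
  by have [/hw->|/ltnW/hw->] := leqP n1 n2.
rewrite [RHS](big_cat_nat (n := n1))//= [X in _ + X]big_nat_cond.
by rewrite [X in _ + X]big1 ?addr0// => j /andP[/andP[/F1]].
Qed.

Section intensity.
Context d (Omega : measurableType d) (R : realType).
Variables (N : point_process Omega R) (mu rho b : R) (g G : R -> R).
Hypotheses (b_gt0 : 0 < b).
Hypothesis gG : subprobability_kernel g G.

Lemma hawkes_intensity_jumps s w : s <= b ->
  hawkes_intensity mu rho g N s w =
  mu + rho * \sum_(x <- jumps N b w | x < s) g (s - x).
Proof.
move=> sb; congr (_ + _ * _); rewrite /Rintegral (@integral_jumps _ _ _ _ b).
- rewrite sumEFin/= [LHS]big_seq_cond [RHS]big_seq_cond; apply: eq_bigl => x.
  have [/jumps_itv/andP[x0 _]|//] := boolP (x \in jumps N b w).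
  by apply/idP/idP; rewrite /= inE/= in_itv/= x0.
- exact: measurable_itv.
- apply/measurable_EFinP/measurable_funTS.
  by apply: measurableT_comp (measurable_kernel gG) _; exact: measurable_funB.
- move=> x; rewrite /= in_itv/= => /andP[_ xs].
  by rewrite lee_fin (kernel_ge0 gG)// subr_ge0 ltW.
- move=> x; rewrite /= in_itv/= => /andP[-> xs].
  by rewrite (ltW (lt_le_trans xs sb)).
Qed.

(** Up to the k-th point in time order, only the first k points can have
    excited the process. *)
Lemma hawkes_intensity_path k s w : s <= jump_time N b k w ->
  hawkes_intensity mu rho g N s w =
  path_intensity mu rho g (fun j => jump_time N b j w) k.+1 s.
Proof.
move=> sk; have sb := le_trans sk (jump_time_le _ _ k w).
rewrite hawkes_intensity_jumps//; congr (_ + _ * _).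
rewrite (big_nth b) big_mkcond/=; apply: sum_nat_eq_support => j hj.
  by rewrite nth_default// ltNge sb.
by rewrite ltNge (le_trans sk)// jump_time_homo// ltnW.
Qed.

End intensity.

Section tail_bound.
Context d (Omega : measurableType d) (R : realType).
Variables (P : probability Omega R) (F : filtration Omega R).
Variables (N : point_process Omega R) (mu rho c b : R) (g G : R -> R) (k : nat).
Hypotheses (mu_ge0 : 0 <= mu) (rho_ge0 : 0 <= rho) (rho_le1 : rho <= 1).
Hypotheses (c_gt0 : 0 < c) (c_le1 : c <= 1) (b_gt0 : 0 < b).
Hypothesis gG : subprobability_kernel g G.
Hypothesis intensityN : stochastic_intensity P F N (hawkes_intensity mu rho g N).

Let adN : adapted_point_process F N.
Proof. by case: intensityN. Qed.

Let t w j := jump_time N b j w.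
Let m w := size (jumps N b w).
Let Z w := path_weight mu rho c G (t w) k.+1.

Let t_gt0 w j : 0 < t w j. Proof. exact: jump_time_gt0. Qed.
Let t_le w j : t w j <= b. Proof. exact: jump_time_le. Qed.
Let t_homo w : {homo t w : i j / (i <= j)%N >-> i <= j}. Proof. exact: jump_time_homo. Qed.
Let t_last w j : (m w <= j)%N -> t w j = b. Proof. exact: jump_time_default. Qed.
Let t_stop j : stopping_time F (fun w => t w j). Proof. exact: stopping_jump_time. Qed.

(** Stopping at a fixed rank keeps the weight bounded, which makes all
    expectations below finite. *)
Definition stopped_weight (x : R * Omega) : R :=
  if (0 < x.1) && (x.1 <= t x.2 k) then Z x.2 x.1 else 0.

Lemma stopped_weight_ge0 x : 0 <= stopped_weight x.
Proof. by rewrite /stopped_weight; case: ifP => // _; exact: path_weight_ge0. Qed.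

(** The weight is a measurable function of the time and of the points that
    occurred strictly before it; times are cut off to be constant off the
    positive half-line. *)
Lemma predictable_stopped_weight : predictable F stopped_weight.
Proof.
have t0 j w : 0 <= t w j by exact: ltW.
pose T := g_sigma_algebraType (predictable_rectangles F).
pose y j (x : T) := if t x.2 j < x.1 then t x.2 j else 0.
pose s (x : T) : R := if 0 < x.1 then x.1 else 0.
have my j : measurable_fun setT (y j).
  exact: (measurable_fun_after_time (t0 j) (t_stop j)).
have ms : measurable_fun setT s by exact: measurable_fun_time.
have mt j : measurable_fun setT (fun x : T => t x.2 j < x.1).
  exact: (measurable_fun_after (t0 j) (t_stop j)).
rewrite /predictable (_ : stopped_weight = (fun x : T =>
  if (cst 0 x.2 < x.1) && ~~ (t x.2 k < x.1) then
   \prod_(0 <= j < k.+1) (if t x.2 j < x.1 then 1 - c else 1) *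
   expR (c * (mu * s x + rho * \sum_(0 <= j < k.+1) (if t x.2 j < x.1 then G (s x - y j x) else 0)))
  else 0)); last first.
  apply/funext => x; rewrite /stopped_weight -leNgt/=; case: ifPn => // /andP[x0 _].
  rewrite /Z /path_weight /s x0; congr (_ * expR (_ * (_ + _ * _))).
  by apply: eq_bigr => j _; rewrite /y; case: ifP.
apply: measurable_fun_ifT => //.
  apply: measurable_and; last exact: measurable_neg.
  exact: (measurable_fun_after (fun=> lexx 0) (stopping_cst F (lexx 0))).
apply: measurable_funM.
  by apply: measurable_prod => j _; exact: measurable_fun_ifT.
apply: measurableT_comp => //; apply: measurable_funM => //; apply: measurable_funD.
  exact: measurable_funM.
apply: measurable_funM => //; apply: measurable_sum => j.
apply: measurable_fun_ifT => //.
by apply: measurableT_comp (measurable_kernel_primitive gG) _; exact: measurable_funB.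
Qed.

Let measurable_weight : measurable_fun setT stopped_weight.
Proof. exact: predictable_measurable predictable_stopped_weight. Qed.

Lemma measurable_jumps_gt n : measurable [set w | (n < m w)%N].
Proof.
rewrite (_ : [set w | _] = [set w | ((n.+1)%:R%:E <= point_measure N w `]0%R, b]%classic)%E]).
  exact: filt_measurable (ltW b_gt0) _ (count_filt _ adN (ltW b_gt0)).
apply/funext => w /=; rewrite (@point_measure_count _ _ _ _ b)//; last first.
  by rewrite lexx ltW.
rewrite lee_fin ler_nat; congr (is_true (_ <= _)%N).
by apply/esym/eqP; rewrite -all_count; apply/allP => x /jumps_itv/andP[].
Qed.

Lemma measurable_jump_time j : measurable_fun setT (t ^~ j).
Proof.
move=> mT; apply: (measurability _ (RGenOInfty.measurableE R)) => //.
move=> /= _ [_ [r ->] <-]; rewrite setTI.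
have [r0|r0] := ltP r 0.
  rewrite (_ : _ @^-1` _ = setT)//; apply/seteqP; split => // w _ /=.
  by rewrite in_itv/= andbT (lt_trans r0).
rewrite (_ : _ @^-1` _ = ~` [set w | t w j <= r]).
  by apply: measurableC; exact: filt_measurable r0 _ (t_stop j r0).
by apply/funext => w /=; rewrite in_itv/= andbT ltNge; apply/propext; split => /negP.
Qed.

Let S w := \sum_(0 <= j < k.+1) (if (j < m w)%N then Z w (t w j) else 0).

Let weight_jump w j : (j < k.+1)%N -> Z w (t w j) = stopped_weight (t w j, w).
Proof. by rewrite ltnS => jk; rewrite /stopped_weight/= t_gt0 t_homo. Qed.

Let measurable_stopped_weight_jump j :
  measurable_fun setT (fun w => stopped_weight (t w j, w)).
Proof.
have mp : measurable_fun setT (fun w => (t w j, w)).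
  by apply: measurable_fun_pair; [exact: measurable_jump_time|exact: measurable_id].
exact: (measurableT_comp measurable_weight mp).
Qed.

Let measurable_fun_jumps_gt j : measurable_fun setT (fun w => (j < m w)%N).
Proof. by apply: (measurable_fun_bool true); rewrite setTI; exact: measurable_jumps_gt. Qed.

Let measurable_S : measurable_fun setT S.
Proof.
rewrite (_ : S = fun w => \sum_(0 <= j < k.+1)
   (if (j < m w)%N then stopped_weight (t w j, w) else 0)).
  apply: measurable_sum => j.
  apply: measurable_fun_ifT.
  - exact: measurable_fun_jumps_gt.
  - exact: measurable_stopped_weight_jump.
  - exact: measurable_cst.
apply/funext => w; rewrite /S big_nat_cond [RHS]big_nat_cond.
by apply: eq_bigr => j /andP[/andP[_ jk] _]; rewrite weight_jump.
Qed.

Let point_integral w :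
  ((S w)%:E <= \int[point_measure N w]_(s in `]0%R, +oo[) (stopped_weight (s, w))%:E)%E.
Proof.
rewrite (@integral_jumps _ _ _ _ b)//.
- rewrite sumEFin lee_fin big_seq_cond (eq_bigl (mem (jumps N b w))); last first.
    move=> x; rewrite [RHS]/=; case: (boolP (x \in jumps N b w)) => // /jumps_itv/andP[x0 _].
    by apply/idP; rewrite /= inE/= in_itv/= x0.
  rewrite -big_seq (big_nth b) -/(m w).
  rewrite (_ : S w = \sum_(0 <= j < m w)
      (if (j < m w)%N && (j < k.+1)%N then stopped_weight (t w j, w) else 0)).
    by apply: ler_sum => j _; case: ifP => // _; exact: stopped_weight_ge0.
  rewrite (sum_nat_eq_support (n2 := k.+1)) => [|j|j]; last 2 first.
  - by rewrite leqNgt => /negbTE ->.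
  - by rewrite [(k.+1 <= j)%N]leqNgt => /negbTE ->; rewrite andbF.
  rewrite /S big_nat_cond [RHS]big_nat_cond.
  by apply: eq_bigr => j /andP[/andP[_ jk] _]; rewrite jk andbT weight_jump.
- apply/measurable_EFinP/measurable_funTS; exact: measurable_fun_pair1.
- by move=> x _; rewrite lee_fin stopped_weight_ge0.
- move=> x /=; rewrite in_itv/= andbT => -> /= xb; rewrite /stopped_weight/=.
  by case: ifPn => // /andP[_ /le_trans] /(_ _ (t_le _ _)); rewrite (negbTE xb).
Qed.

Let intensity_integral w :
  (\int[lebesgue_measure]_(s in `]0%R, +oo[)
     (stopped_weight (s, w) * hawkes_intensity mu rho g N s w)%:E =
   \int[lebesgue_measure]_(s in `]0%R, t w k])
     (Z w s * path_intensity mu rho g (t w) k.+1 s)%:E)%E.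
Proof.
rewrite integral_mkcond [RHS]integral_mkcond; apply: eq_integral => s _.
rewrite !patchE.
have -> : (s \in `]0, t w k]%classic) = (0 < s <= t w k).
  by apply/idP/idP; rewrite inE/= in_itv.
have -> : (s \in `]0, +oo[%classic) = (0 < s).
  by apply/idP/idP; rewrite inE/= in_itv/= andbT.
rewrite /stopped_weight/=.
case: (0 < s) => //=; case sk : (s <= t w k) => /=; last by rewrite mul0r.
by rewrite (hawkes_intensity_path _ _ gG sk).
Qed.

Let I w := (\int[lebesgue_measure]_(s in `]0%R, +oo[)
     (stopped_weight (s, w) * hawkes_intensity mu rho g N s w)%:E)%E.

Let measurable_I : measurable_fun setT I.
Proof.
have [_ _ plam _ _] := intensityN.
have mlam := predictable_measurable plam.
pose f (x : R * Omega) := (stopped_weight x *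
  (if 0 < x.1 then hawkes_intensity mu rho g N x.1 x.2 else 0))%:E.
have lam0 x : 0 <= (if 0 < x.1 then hawkes_intensity mu rho g N x.1 x.2 else 0).
  by have [_ l0 _ _ _] := intensityN; case: ifP.
have -> : I = fubini_G (@lebesgue_measure R) f.
  apply/funext => w; rewrite /I /fubini_G [LHS]integral_mkcond.
  congr (integral _ _ _); apply/funext => s.
  rewrite patchE /f /= (_ : (s \in `]0, +oo[%classic) = (0 < s)); last first.
    by apply/idP/idP; rewrite inE/= in_itv/= andbT.
  by case: ifP => //; rewrite mulr0.
apply: measurable_fun_fubini_tonelli_G.
  by apply/measurable_EFinP; exact: measurable_funM.
by move=> x; rewrite lee_fin mulr_ge0// stopped_weight_ge0.
Qed.

Let q := (1 - c) * expR c.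
Let V w := expR (c * mu * b) * (if (k < m w)%N then q ^+ k.+1 else 1).

Let q_ge0 : 0 <= q.
Proof. by rewrite mulr_ge0 ?subr_ge0 ?expR_ge0. Qed.

Let q_le1 : q <= 1.
Proof.
rewrite /q -(expRK c) -ler_pdivlMr ?expR_gt0// div1r -expRN expRK.
exact: expR_ge1Dx.
Qed.

(** Each point counts a factor 1 - c, and raises the compensator by at most
    one, hence a factor at most [q] in total; the padding points count
    nothing. *)
Let final_weight_le w :
  \prod_(0 <= j < k.+1) (if (j < m w)%N then 1 - c else 1) *
    expR (c * (mu * t w k + rho * \sum_(0 <= j < k.+1) G (t w k - t w j))) <= V w.
Proof.
rewrite mulrDr expRD mulrCA mulrA [c * (rho * _)]mulrA mulr_sumr expR_sum -mulrA.
rewrite -big_split/=; apply: ler_pM.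
- exact: expR_ge0.
- by apply: prodr_ge0 => j _; rewrite mulr_ge0 ?expR_ge0//; case: ifP; rewrite ?subr_ge0.
- by rewrite ler_expR -mulrA ler_wpM2l ?ler_wpM2l// ltW.
rewrite (_ : (if _ then _ else _) = \prod_(0 <= j < k.+1) (if (k < m w)%N then q else 1)); last first.
  by rewrite prodr_const_nat subn0; case: ifP; rewrite ?expr1n.
have leq j : (j < k.+1)%N -> (1 - c) * expR (c * rho * G (t w k - t w j)) <= q.
  rewrite ltnS => jk; rewrite ler_wpM2l ?subr_ge0// ler_expR -mulrA ger_pMr//.
  by rewrite (le_trans _ rho_le1)// ler_piMr// (kernel_primitive_le1 gG)// subr_ge0 t_homo.
rewrite big_nat_cond [leRHS]big_nat_cond; apply: ler_prod => j /andP[/andP[_ jk] _].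
rewrite mulr_ge0 ?expR_ge0//=; last by case: ifP; rewrite ?subr_ge0.
have [km|mk] := ltnP k (m w); first by rewrite (leq_trans jk km) leq.
case: ifPn => [_|]; first exact: le_trans (leq _ jk) q_le1.
rewrite -leqNgt => mj.
by rewrite (t_last mk) (t_last mj) subrr (kernel_primitive0 gG) mulr0 expR0 mulr1.
Qed.

Let pathwise w : (1 + c%:E * I w <= (V w)%:E + c%:E * (S w)%:E)%E.
Proof.
have [J [JE]] := exponential_path k.+1 c_gt0 c_le1 mu_ge0 rho_ge0 gG (t_gt0 w)
  (t_le w) (@t_homo w) (@t_last w).
rewrite /I intensity_integral JE -!EFinM -!EFinD lee_fin => /le_trans; apply.
by rewrite lerD2r final_weight_le.
Qed.

Let V_ge0 w : 0 <= V w.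
Proof. by rewrite mulr_ge0 ?expR_ge0//; case: ifP => // _; rewrite exprn_ge0. Qed.

Let S_ge0 w : 0 <= S w.
Proof. by apply: sumr_ge0 => j _; case: ifP => // _; exact: path_weight_ge0. Qed.

Let measurable_V : measurable_fun setT V.
Proof.
apply: measurable_funM; first exact: measurable_cst.
by apply: measurable_fun_ifT; [exact: measurable_fun_jumps_gt|exact: measurable_cst..].
Qed.

Let I_ge0 w : (0 <= I w)%E.
Proof.
apply: integral_ge0 => s _; rewrite lee_fin mulr_ge0 ?stopped_weight_ge0//.
by have [_ l0 _ _ _] := intensityN.
Qed.

(** This is where the intensity enters: the expected sum of the weight over the
    points equals the expected integral of weight times intensity. *)
Let expectation_S_le : (\int[P]_w (S w)%:E <= \int[P]_w I w)%E.
Proof.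
have [_ _ _ _ <-] := intensityN; last 2 first.
- exact: predictable_stopped_weight.
- exact: stopped_weight_ge0.
by apply: ge0_le_integralT => [w|]; rewrite ?lee_fin.
Qed.

Let S_bound w : S w <= k.+1%:R * expR (c * (mu * b + rho * k.+1%:R)).
Proof.
have Zle s : s <= b -> Z w s <= expR (c * (mu * b + rho * k.+1%:R)).
  move=> sb; rewrite -[leRHS]mul1r; apply: ler_pM.
  - by apply: prodr_ge0 => j _; case: ifP => // _; rewrite subr_ge0.
  - exact: expR_ge0.
  - rewrite -[leRHS](expr1n _ (k.+1 - 0)) -prodr_const_nat; apply: ler_prod => j _.
    by case: ifP => _; rewrite ?ler01 ?lexx// subr_ge0 c_le1 gerBl ltW.
  - rewrite ler_expR ler_wpM2l ?(ltW c_gt0)// lerD ?ler_wpM2l//.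
    rewrite -[leRHS]/(1 *+ k.+1) -[in leRHS](subn0 k.+1) -sumr_const_nat.
    apply: ler_sum => j _; case: ifP => // ts.
    by rewrite (kernel_primitive_le1 gG)// subr_ge0 ltW.
rewrite mulr_natl -[in leRHS](subn0 k.+1) -sumr_const_nat; apply: ler_sum => j _.
by case: ifP => _; [exact: Zle|exact: expR_ge0].
Qed.

Let expectation_V_ge1 : (1 <= \int[P]_w (V w)%:E)%E.
Proof.
have mI := measurable_I; have mV : measurable_fun setT (EFin \o V).
  exact/measurable_EFinP/measurable_V.
have mS : measurable_fun setT (EFin \o S) by exact/measurable_EFinP/measurable_S.
have c0 : (0 <= c)%R by exact: ltW.
have EIE : (\int[P]_w (1 + c%:E * I w) = 1 + c%:E * \int[P]_w I w)%E.
  rewrite ge0_integralD//.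
  - rewrite integral_cst//; congr (_ + _)%E.
      by rewrite mul1e; exact: probability_setT.
    by rewrite ge0_integralZl_EFin.
  - by move=> w _; rewrite mule_ge0.
  - exact: measurable_funeM.
have EVS : (\int[P]_w ((V w)%:E + c%:E * (S w)%:E) =
    \int[P]_w (V w)%:E + c%:E * \int[P]_w (S w)%:E)%E.
  rewrite ge0_integralD//.
  - by rewrite ge0_integralZl_EFin// => w _; rewrite lee_fin.
  - by move=> w _; rewrite lee_fin.
  - by move=> w _; rewrite mule_ge0// lee_fin.
  - exact: measurable_funeM.
have le1 : (1 + c%:E * \int[P]_w I w <= \int[P]_w (V w)%:E + c%:E * \int[P]_w (S w)%:E)%E.
  rewrite -EIE -EVS; apply: ge0_le_integralT => w; last exact: pathwise.
  by rewrite adde_ge0// mule_ge0.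
have bound (f : Omega -> R) r : (forall w, 0 <= f w) -> (forall w, f w <= r) ->
    (\int[P]_w (f w)%:E)%E \is a fin_num.
  move=> f0 fr; rewrite ge0_fin_numE; last by apply: integral_ge0 => w _; rewrite lee_fin.
  apply: (@le_lt_trans _ _ (\int[P]_w r%:E)%E).
    by apply: ge0_le_integralT => w; rewrite lee_fin.
  rewrite integral_cst// [X in (_ * X)%E](_ : _ = 1%E) ?mule1 ?ltry//.
  exact: probability_setT.
have fV : (\int[P]_w (V w)%:E)%E \is a fin_num.
  apply: (bound _ (expR (c * mu * b))) => // w; rewrite /V ler_piMr ?expR_ge0//.
  by case: ifP => // _; rewrite exprn_ile1.
have fS : (\int[P]_w (S w)%:E)%E \is a fin_num by exact: bound S_ge0 S_bound.
have I0 : (0 <= \int[P]_w I w)%E by apply: integral_ge0.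
have := le1; have := expectation_S_le; rewrite -(fineK fV) -(fineK fS).
move: I0; case: (\int[P]_w I w)%E => [i| |] //.
  by rewrite !lee_fin -?EFinM -?EFinD ?lee_fin; nra.
by rewrite gt0_muley ?lte_fin// addey.
Qed.

(** The expectation of [V] is the exponential of [c mu b] times the expectation
    of a variable equal to [q ^+ k.+1] on the event and to one elsewhere; that
    it is at least one bounds the probability of the event. *)
Lemma jumps_tail :
  (P [set w | (k < size (jumps N b w))%N] *
    (1 - ((1 - c) * expR c) ^+ k.+1)%:E <= (c * mu * b)%:E)%E.
Proof.
rewrite -/q.
set B := [set w | _]; have mB : measurable B by exact: measurable_jumps_gt.
set e := expR (c * mu * b).
have q0 : 0 <= 1 - q ^+ k.+1 by rewrite subr_ge0 exprn_ile1.
have EV : (\int[P]_w (V w)%:E + (e * (1 - q ^+ k.+1))%:E * P B = e%:E)%E.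
  have -> : P B = (\int[P]_w (\1_B w)%:E)%E by rewrite integral_indic// setIT.
  have mb : measurable_fun setT (fun w => (\1_B w : R)%:E).
    exact/measurable_EFinP/measurable_indic.
  have e0 : 0 <= e * (1 - q ^+ k.+1) by rewrite mulr_ge0 ?expR_ge0.
  rewrite -ge0_integralZl_EFin// -ge0_integralD//; last 4 first.
  - by move=> w _; rewrite lee_fin.
  - exact/measurable_EFinP/measurable_V.
  - by move=> w _; rewrite -EFinM lee_fin mulr_ge0.
  - exact: measurable_funeM.
  transitivity (\int[P]_w (cst e%:E w))%E; last first.
    rewrite integral_cst// [X in (_ * X)%E](_ : _ = 1%E) ?mule1//.
    exact: probability_setT.
  apply: eq_integral => w _; rewrite -EFinM -EFinD/=; congr EFin.
  rewrite /V -/e indicE; case: ifPn => km.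
    by rewrite mem_set//= mulr1; ring.
  by rewrite memNset//= ?mulr0 ?addr0 ?mulr1//; exact/negP.
have := expectation_V_ge1; move: EV.
rewrite -(fineK (fin_num_measure P B mB)).
set p := fine (P B).
case: (\int[P]_w (V w)%:E)%E => [v| |] //=.
rewrite -!EFinM -EFinD => -[vE]; rewrite !lee_fin => v1.
have e0 : 0 < e by exact: expR_gt0.
have : e * (p * (1 - q ^+ k.+1)) <= e * (1 - expR (- (c * mu * b))).
  have ee : e * expR (- (c * mu * b)) = 1 by rewrite /e -expRD subrr expR0.
  by rewrite [leRHS]mulrBr mulr1 ee; lra.
rewrite ler_pM2l// => /le_trans; apply.
by have := expR_ge1Dx (- (c * mu * b)); lra.
Qed.

End tail_bound.

(** The product is at most 1 - c^2 / 4, because exp(-c) is at least the square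
    of 1 - c / 2; this second-order gain is what makes [4 / c ^+ 2] the scale of
    the number of points. *)
Lemma expR_weight_half (R : realType) (c : R) n : 0 < c -> c <= 1 ->
  4 / c ^+ 2 <= n%:R -> ((1 - c) * expR c) ^+ n <= 1 / 2.
Proof.
move=> c0 c1 cn.
have q1 : (1 - c) * expR c <= 1 - c ^+ 2 / 4.
  have e2 : (1 - c / 2) ^+ 2 <= expR (- c).
    rewrite (_ : - c = - (c / 2) + - (c / 2)); last by field.
    rewrite expRD -expr2 lerXn2r ?nnegrE ?expR_ge0//; last exact: expR_ge1Dx.
    by lra.
  rewrite -(expRK c) -ler_pdivlMr ?expR_gt0// -expRN expRK.
  apply: (@le_trans _ _ ((1 - c ^+ 2 / 4) * (1 - c / 2) ^+ 2)); first by nra.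
  by apply: ler_wpM2l => //; nra.
have q0 : 0 <= (1 - c) * expR c by rewrite mulr_ge0 ?subr_ge0 ?expR_ge0.
have q2 : (1 - c) * expR c <= expR (- (c ^+ 2 / 4)).
  exact: le_trans q1 (expR_ge1Dx _).
apply: (@le_trans _ _ (expR (- (c ^+ 2 / 4)) ^+ n)).
  by rewrite lerXn2r ?nnegrE ?expR_ge0.
rewrite -expRM_natl.
apply: (@le_trans _ _ (expR (-1))).
  rewrite ler_expR mulrN lerN2 mulrA ler_pdivlMr// mul1r.
  by move: cn; rewrite ler_pdivrMr ?exprn_gt0.
rewrite expRN div1r lef_pV2 ?posrE ?expR_gt0//.
by have := expR_ge1Dx (1 : R); lra.
Qed.

(** * Lower bound on the integral of the inverse intensity *)

Lemma measurable_funV_gt0 d (T : measurableType d) (R : realType) (D : set T)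
    (f : T -> R) : measurable_fun D f -> (forall x, D x -> 0 < f x) ->
  measurable_fun D (fun x => (f x)^-1).
Proof.
move=> mf f0.
have mV : measurable_fun `](0 : R), +oo[ (@GRing.inv R).
  apply: open_continuous_measurable_fun => // y; rewrite inE/= in_itv/= andbT => y0.
  by apply: inv_continuous; rewrite gt_eqF.
apply: (measurable_comp _ _ mV mf) => //.
by move=> _ [y yab <-]; rewrite /= in_itv/= andbT f0.
Qed.

(** Tangent-line form of the harmonic mean inequality: 1 / y >= 2 / x - y / x^2,
    integrated for the optimal constant [x], the bound on the mean of [f]. *)
Lemma integral_inv_ge (R : realType) (f : R -> R) (a b X : R) : a < b -> 0 < X ->
  measurable_fun `]a, b] f -> (forall x, `]a, b]%classic x -> 0 < f x) ->
  (\int[lebesgue_measure]_(x in `]a, b]) (f x)%:E <= X%:E)%E ->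
  (((b - a) ^+ 2 / X)%:E <= \int[lebesgue_measure]_(x in `]a, b]) ((f x)^-1)%:E)%E.
Proof.
move=> ab X0 mf f0 fX; set x := X / (b - a).
have ba0 : 0 < b - a by rewrite subr_gt0.
have x0 : 0 < x by rewrite divr_gt0.
have mfE : measurable_fun `]a, b] (EFin \o f) by exact/measurable_EFinP.
have mfV : measurable_fun `]a, b] (fun y => ((f y)^-1)%:E).
  by apply/measurable_EFinP; exact: measurable_funV_gt0.
have h : (\int[lebesgue_measure]_(y in `]a, b]) (2 / x)%:E <=
  \int[lebesgue_measure]_(y in `]a, b]) (((f y)^-1)%:E + (x ^- 2)%:E * (f y)%:E))%E.
  apply: ge0_le_integral => //.
  - by move=> y _; rewrite lee_fin divr_ge0// ltW.
  - by apply: emeasurable_funD => //; exact: measurable_funeM.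
  - move=> y yab; rewrite -EFinM -EFinD lee_fin.
    have fy := f0 _ yab.
    rewrite -subr_ge0 (_ : _ - _ = (f y)^-1 * (1 - f y / x) ^+ 2).
      by rewrite mulr_ge0 ?sqr_ge0 ?invr_ge0 ?ltW.
    by field; rewrite !gt_eqF.
move: h; rewrite integral_cst//= lebesgue_measure_itv/= lte_fin ab -EFinD -EFinM.
rewrite ge0_integralD//; last 3 first.
- by move=> y yab; rewrite lee_fin invr_ge0 ltW// f0.
- by move=> y yab; rewrite mule_ge0// lee_fin ?invr_ge0 ?exprn_ge0 ?ltW// f0.
- exact: measurable_funeM.
rewrite ge0_integralZl_EFin//; last 2 first.
- by move=> y yab; rewrite lee_fin ltW// f0.
- by rewrite invr_ge0 exprn_ge0// ltW.
move=> h.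
have {}h := le_trans h (leeD2l _ (lee_wpmul2l _ fX)).
have {h} : ((2 / x * (b - a))%:E <=
   \int[lebesgue_measure]_(y in `]a, b]) ((f y)^-1)%:E + (x ^- 2 * X)%:E)%E.
  by apply: h; rewrite lee_fin invr_ge0 exprn_ge0// ltW.
rewrite -leeBlDr// -EFinB; apply: le_trans; rewrite lee_fin.
rewrite /x le_eqVlt; apply/orP; left; apply/eqP.
by field; rewrite !gt_eqF.
Qed.

Section total_intensity.
Context d (Omega : measurableType d) (R : realType).
Variables (N : point_process Omega R) (mu rho b : R) (g G : R -> R).
Hypotheses (mu_ge0 : 0 <= mu) (rho_ge0 : 0 <= rho) (rho_le1 : rho <= 1) (b_gt0 : 0 < b).
Hypothesis gG : subprobability_kernel g G.

Lemma integral_shifted_kernel x : 0 < x <= b ->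
  (\int[lebesgue_measure]_(s in `]0%R, b]) (if x < s then g (s - x) else 0)%:E <= 1)%E.
Proof.
move=> /andP[x0 xb].
have -> : (\int[lebesgue_measure]_(s in `]0%R, b]) (if x < s then g (s - x) else 0)%:E =
    \int[lebesgue_measure]_(s in `]x, b]) (g (s - x))%:E)%E.
  rewrite integral_mkcond [RHS]integral_mkcond; apply: eq_integral => s _.
  rewrite !patchE.
  have -> : (s \in `]0, b]%classic) = (0 < s <= b).
    by apply/idP/idP; rewrite inE/= in_itv.
  have -> : (s \in `]x, b]%classic) = (x < s <= b).
    by apply/idP/idP; rewrite inE/= in_itv.
  case xs : (x < s); first by rewrite (lt_trans x0 xs).
  by case: ifP.
have dG s : x <= s <= b -> is_derive s 1 (fun s => G (s - x)) (g (s - x)).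
  move=> /andP[xs _]; rewrite -[g _]mulr1.
  apply: (@is_derive1_comp _ G (fun s => s - x)).
    by apply: (kernel_is_derive gG); rewrite subr_ge0.
  by rewrite -[X in is_derive _ _ _ X]subr0; exact: is_deriveB.
rewrite (integral_derive xb dG).
  rewrite lee_fin subrr (kernel_primitive0 gG) subr0 (kernel_primitive_le1 gG)//.
  by rewrite subr_ge0.
move=> s /andP[xs _]; apply: (@continuous_comp _ _ _ (fun y => y - x) g).
  by apply: cvgB => //; exact: cvg_cst.
by apply: (kernel_continuous gG); rewrite subr_ge0.
Qed.

Lemma measurable_hawkes_intensity w :
  measurable_fun `]0, b] (fun s => hawkes_intensity mu rho g N s w).
Proof.
apply: (@eq_measurable_fun _ _ _ _ _
    (fun s => mu + rho * \sum_(x <- jumps N b w) (if x < s then g (s - x) else 0))).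
  move=> s; rewrite inE/= in_itv/= => /andP[_ sb].
  by rewrite (hawkes_intensity_jumps N mu rho gG w sb) -big_mkcond.
apply: measurable_funTS; apply: measurable_funD => //; apply: measurable_funM => //.
apply: measurable_sum => x; apply: measurable_fun_ifT => //.
  exact: measurable_fun_ltr.
by apply: measurableT_comp (measurable_kernel gG) _; exact: measurable_funB.
Qed.

(** Each point adds to the compensator at most the mass of the kernel. *)
Lemma integral_hawkes_intensity_le w :
  (\int[lebesgue_measure]_(s in `]0%R, b]) (hawkes_intensity mu rho g N s w)%:E <=
   (mu * b + (size (jumps N b w))%:R)%:E)%E.
Proof.
pose h x s : R := if x < s then g (s - x) else 0.
have h0 x s : 0 <= h x s.
  by rewrite /h; case: ifP => // xs; rewrite (kernel_ge0 gG)// subr_ge0 ltW.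
have mh x : measurable_fun setT (h x).
  apply: measurable_fun_ifT => //; first exact: measurable_fun_ltr.
  by apply: measurableT_comp (measurable_kernel gG) _; exact: measurable_funB.
have -> : (\int[lebesgue_measure]_(s in `]0%R, b]) (hawkes_intensity mu rho g N s w)%:E =
    \int[lebesgue_measure]_(s in `]0%R, b])
      (mu%:E + rho%:E * \sum_(x <- jumps N b w) (h x s)%:E))%E.
  apply: eq_integral => s; rewrite inE/= in_itv/= => /andP[_ sb].
  by rewrite (hawkes_intensity_jumps N mu rho gG w sb) sumEFin -big_mkcond -EFinM -EFinD.
have mhE x : measurable_fun `]0, b] (fun s => (h x s)%:E).
  by apply/measurable_EFinP; exact: measurable_funTS.
rewrite ge0_integralD//; last 2 first.
- by move=> s _; rewrite mule_ge0// sumEFin lee_fin sumr_ge0.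
- by apply: measurable_funeM; exact: emeasurable_sum.
rewrite EFinD; apply: leeD.
  by rewrite integral_cst//= lebesgue_measure_itv/= lte_fin b_gt0 -EFinD subr0 -EFinM.
rewrite ge0_integralZl_EFin//; last 2 first.
- by move=> s _; rewrite sumEFin lee_fin sumr_ge0.
- exact: emeasurable_sum.
rewrite ge0_integral_sum//; last by move=> x s _; rewrite lee_fin.
apply: (@le_trans _ _ (1 * \sum_(x <- jumps N b w) 1)%E); last first.
  by rewrite mul1e sumEFin big_const_seq count_predT iter_addr_0.
apply: lee_pmul; rewrite ?lee_fin//.
  by apply: sume_ge0 => x _; apply: integral_ge0 => s _; rewrite lee_fin.
rewrite big_seq [leRHS]big_seq; apply: lee_sum => x xj.
exact/integral_shifted_kernel/jumps_itv/xj.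
Qed.

End total_intensity.

(** * Many scales contribute *)

Section dyadic_scales.
Context d (Omega : measurableType d) (R : realType).
Variables (P : probability Omega R) (F : filtration Omega R).
Variables (N : point_process Omega R) (mu rho delta : R) (g G : R -> R).
Hypotheses (mu_gt0 : 0 < mu) (rho_ge0 : 0 <= rho) (rho_le1 : rho <= 1).
Hypotheses (delta_gt0 : 0 < delta) (delta_le1 : delta <= 1).
Hypothesis gG : subprobability_kernel g G.
Hypothesis intensityN : stochastic_intensity P F N (hawkes_intensity mu rho g N).

(* The scale [b j] sees 2 ^+ j immigrants on average, and [c j] is chosen so
   that [c j * mu * b j = delta], which is half the bound on the probability of
   [bad j]; [k j] is the first rank to which [expR_weight_half] applies, ranks being
   counted from zero. *)
Let b j : R := 2 ^+ j / mu.
Let c j : R := delta / 2 ^+ j.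
Let k j := Num.truncn (4 / c j ^+ 2).
Let bad j := [set w | (k j < size (jumps N (b j) w))%N].
Let eta := delta ^+ 2 / 20.

Let b_gt0 j : 0 < b j.
Proof. by rewrite divr_gt0// exprn_gt0. Qed.

Let pow2_ge1 j : 1 <= 2 ^+ j :> R.
Proof. by rewrite exprn_ege1// ler1n. Qed.

Let measurable_bad j : measurable (bad j).
Proof. exact: (measurable_jumps_gt (b_gt0 j) intensityN). Qed.

Let bad_le j : (P (bad j) <= (2 * delta)%:E)%E.
Proof.
have pj : 0 < 2 ^+ j :> R by exact: exprn_gt0.
have c0 : 0 < c j by rewrite divr_gt0.
have c1 : c j <= 1 by rewrite ler_pdivrMr// mul1r (le_trans delta_le1).
have := jumps_tail (k j) (ltW mu_gt0) rho_ge0 rho_le1 c0 c1 (b_gt0 j) gG intensityN.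
rewrite -/(bad j) (_ : c j * mu * b j = delta); last first.
  by rewrite /c /b; field; rewrite !gt_eqF.
have qh : ((1 - c j) * expR (c j)) ^+ (k j).+1 <= 1 / 2.
  by apply: expR_weight_half => //; exact/ltW/truncnS_gt.
rewrite -(fineK (fin_num_measure P _ (measurable_bad j))) -EFinM !lee_fin.
have : 0 <= fine (P (bad j)) by exact: fine_ge0.
nra.
Qed.

Let intensity_gt0 t w : 0 < t -> 0 < hawkes_intensity mu rho g N t w.
Proof.
move=> t0; rewrite (hawkes_intensity_jumps N mu rho gG w (lexx t)) ltr_pwDl// mulr_ge0//.
by apply: sumr_ge0 => x xt; rewrite (kernel_ge0 gG)// subr_ge0 ltW.
Qed.

Let inv_intensity_ge0 t w : (0 <= ((hawkes_intensity mu rho g N t w)^-1)%:E)%E.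
Proof.
have [_ l0 _ _ _] := intensityN.
by rewrite lee_fin invr_ge0.
Qed.

Let b_lt j : b j < b j.+1.
Proof. by rewrite ltr_pM2r ?invr_gt0// exprS ltr_pMl ?exprn_gt0// ltr1n. Qed.

(** Off the bad event the integrated intensity is at most of order
    4 ^+ j / delta ^+ 2, against a squared window length of 4 ^+ j / mu ^+ 2. *)
Let information_block j w : ~ bad j.+1 w ->
  (eta%:E <= (mu ^+ 2)%:E * \int[lebesgue_measure]_(t in `]b j, b j.+1])
     ((hawkes_intensity mu rho g N t w)^-1)%:E)%E.
Proof.
move=> /negP; rewrite -leqNgt => mk.
have sub : `]b j, b j.+1] `<=` `]0, b j.+1].
  by apply: subset_itvr; rewrite bnd_simp ltW.
have mlam := measurable_hawkes_intensity N mu rho gG w.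
pose X := mu * b j.+1 + (k j.+1)%:R.
have X0 : 0 < X by rewrite ltr_pwDl// mulr_gt0.
have lX : (\int[lebesgue_measure]_(t in `]b j, b j.+1])
    (hawkes_intensity mu rho g N t w)%:E <= X%:E)%E.
  apply: (@le_trans _ _ (\int[lebesgue_measure]_(t in `]0%R, b j.+1])
    (hawkes_intensity mu rho g N t w)%:E)%E).
    apply: ge0_subset_integral => //.
      by apply/measurable_EFinP; exact: mlam.
    by move=> t; rewrite /= in_itv/= => /andP[t0 _]; rewrite lee_fin ltW// intensity_gt0.
  apply: le_trans (integral_hawkes_intensity_le N (ltW mu_gt0) rho_ge0 rho_le1 (b_gt0 j.+1) gG w) _.
  by rewrite lee_fin lerD2l ler_nat.
have := integral_inv_ge (b_lt j) X0 (measurable_funS _ sub (mlam _)) _ lX.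
move=> /(_ (measurable_itv _)) h.
apply: (@le_trans _ _ ((mu ^+ 2)%:E * ((b j.+1 - b j) ^+ 2 / X)%:E)%E); last first.
  apply: lee_wpmul2l; first by rewrite lee_fin exprn_ge0// ltW.
  apply: h => t; rewrite /= in_itv/= => /andP[bt _]; apply: intensity_gt0.
  exact: lt_trans (b_gt0 j) bt.
rewrite -EFinM lee_fin mulrA ler_pdivlMr//.
have B1 := pow2_ge1 j.
have -> : mu ^+ 2 * (b j.+1 - b j) ^+ 2 = (2 ^+ j) ^+ 2.
  by rewrite /b (exprS 2 j); field; rewrite gt_eqF.
have kX : (k j.+1)%:R <= 16 * (2 ^+ j) ^+ 2 / delta ^+ 2.
  apply: (@le_trans _ _ (4 / c j.+1 ^+ 2)); first by rewrite truncn_le divr_ge0// sqr_ge0.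
  rewrite le_eqVlt; apply/orP; left; apply/eqP.
  by rewrite /c (exprS 2 j); field; rewrite !gt_eqF// exprn_gt0.
have -> : X = 2 * 2 ^+ j + (k j.+1)%:R.
  by rewrite /X /b (exprS 2 j); congr (_ + _); field; rewrite gt_eqF.
have d2 : delta ^+ 2 <= 1 by rewrite exprn_ile1// ltW.
have ek : eta * (k j.+1)%:R <= eta * (16 * (2 ^+ j) ^+ 2 / delta ^+ 2).
  by apply: ler_wpM2l => //; rewrite divr_ge0// exprn_ge0// ltW.
have e16 : eta * (16 * (2 ^+ j) ^+ 2 / delta ^+ 2) = 16 / 20 * (2 ^+ j) ^+ 2.
  by rewrite /eta; field; rewrite gt_eqF.
have e1 : eta <= 1 / 20 by rewrite /eta; lra.
rewrite mulrDr; nra.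
Qed.

Let measurable_inv_intensity (a T : R) w : 0 <= a ->
  measurable_fun `]a, T] (fun t => ((hawkes_intensity mu rho g N t w)^-1)%:E).
Proof.
move=> a0; have sub : `]a, T] `<=` `]0, T] by apply: subset_itvr; rewrite bnd_simp.
apply/measurable_EFinP; apply: measurable_funV_gt0.
  exact: measurable_funS (measurable_itv _) sub (measurable_hawkes_intensity N mu rho gG w).
by move=> t /sub; rewrite /= in_itv/= => /andP[t0 _]; exact: intensity_gt0.
Qed.

Let information_ge J w :
  ((eta * \sum_(0 <= j < J) (1 - \1_(bad j.+1) w))%:E <=
   (mu ^+ 2)%:E * \int[lebesgue_measure]_(t in `]b 0%N, b J])
     ((hawkes_intensity mu rho g N t w)^-1)%:E)%E.
Proof.
elim: J => [|J IH].
  by rewrite set_itvoc0 integral_set0 mule0 big_nil mulr0.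
have b0J : b 0%N <= b J.
  by rewrite ler_pM2r ?invr_gt0// expr0 pow2_ge1.
rewrite (@itv_bndbnd_setU _ _ _ (BRight (b J))) ?bnd_simp//; last exact/ltW/b_lt.
rewrite ge0_integral_setU//; last 2 first.
- rewrite -itv_bndbnd_setU ?bnd_simp//; last exact/ltW/b_lt.
  by apply: measurable_inv_intensity; exact: ltW.
- apply/disj_setPS => x [/=]; rewrite !in_itv/= => /andP[_ xp] /andP[].
  by rewrite ltNge xp.
rewrite ge0_muleDr; last 2 first.
- by apply: integral_ge0.
- by apply: integral_ge0.
rewrite big_nat_recr//= mulrDr EFinD; apply: leeD => //.
have [wb|wb] := pselect (bad J.+1 w).
  rewrite indicE mem_set// subrr mulr0; apply: mule_ge0; last exact: integral_ge0.
  by rewrite lee_fin exprn_ge0// ltW.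
by rewrite indicE memNset// subr0 mulr1; exact: information_block.
Qed.

Let observed_informationE T w : observed_information mu rho g N T w =
  ((mu ^+ 2)%:E * \int[lebesgue_measure]_(t in `]0%R, T])
     ((hawkes_intensity mu rho g N t w)^-1)%:E)%E.
Proof.
rewrite /observed_information -integral_itv_obnd_cbnd//.
exact: measurable_inv_intensity.
Qed.

(** Predictability gives joint measurability of the intensity, and Tonelli's
    theorem does the rest.  The value 1 at nonpositive times keeps the function
    to be inverted positive. *)
Let measurable_information T : measurable_fun setT (observed_information mu rho g N T).
Proof.
have [_ _ plam _ _] := intensityN.
have mlam := predictable_measurable plam.
pose lam (x : R * Omega) := if 0 < x.1 then hawkes_intensity mu rho g N x.1 x.2 else 1.
have mpos : measurable_fun setT (fun x : R * Omega => 0 < x.1).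
  by apply: measurable_fun_ltr => //; exact: measurable_fst.
have ml : measurable_fun setT lam.
  rewrite (_ : lam = (fun x : R * Omega => if 0 < x.1 then
      (if 0 < x.1 then hawkes_intensity mu rho g N x.1 x.2 else 0) else 1)).
    by apply: measurable_fun_ifT => //; exact: mlam.
  by apply/funext => x; rewrite /lam; case: ifP.
have mlV : measurable_fun setT (fun x => (lam x)^-1).
  apply: measurable_funV_gt0 => // x _; rewrite /lam; case: ifP => // x0.
  exact: intensity_gt0.
pose f (x : R * Omega) := (if (0 < x.1) && (x.1 <= T) then (lam x)^-1 else 0)%:E.
have -> : observed_information mu rho g N T =
    (fun w => (mu ^+ 2)%:E * fubini_G (@lebesgue_measure R) f w)%E.
  apply/funext => w; rewrite observed_informationE /fubini_G; congr (_ * _)%E.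
  rewrite [LHS]integral_mkcond; congr (integral _ _ _); apply/funext => s.
  rewrite patchE /f /lam /= (_ : (s \in `]0, T]%classic) = (0 < s <= T)); last first.
    by apply/idP/idP; rewrite inE/= in_itv.
  by case: (0 < s) => //=; case: ifP.
apply: measurable_funeM; apply: measurable_fun_fubini_tonelli_G.
  apply/measurable_EFinP; apply: measurable_fun_ifT => //.
  apply: measurable_and => //; apply: measurable_fun_ler => //; exact: measurable_fst.
move=> x; rewrite lee_fin; case: ifP => // /andP[x0 _]; rewrite /lam x0 invr_ge0 ltW//.
exact: intensity_gt0.
Qed.

(** If the information is at most [M], then more than half of the scales are
    bad; by Markov's inequality for the number of bad scales this has
    probability at most 4 delta. *)
Lemma information_large M T J : (0 < J)%N -> M < eta * (J%:R / 2) -> 2 ^+ J <= mu * T ->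
  let E := [set w | (M%:E < observed_information mu rho g N T w)%E] in
  measurable E /\ ((1 - 4 * delta)%:E <= P E)%E.
Proof.
move=> J0 MJ JT E.
have mE : measurable E.
  by have := emeasurable_fun_o_infty measurableT (measurable_information T) M%:E; rewrite setTI.
split => //.
have mEC : measurable (~` E) by exact: measurableC.
have bT : b J <= T by rewrite ler_pdivrMr// mulrC.
have eta_gt0 : 0 < eta by rewrite divr_gt0// exprn_gt0.
pose nbad w : R := \sum_(0 <= j < J) \1_(bad j.+1) w.
have obs_ge w : ((eta * (J%:R - nbad w))%:E <= observed_information mu rho g N T w)%E.
  rewrite (_ : J%:R - nbad w = \sum_(0 <= j < J) (1 - \1_(bad j.+1) w)); last first.
    by rewrite sumrB sumr_const_nat subn0.
  apply: le_trans (information_ge J w) _; rewrite observed_informationE.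
  apply: lee_wpmul2l; first by rewrite lee_fin exprn_ge0// ltW.
  apply: ge0_subset_integral => //; first exact: measurable_inv_intensity.
  by apply: subset_itv; rewrite bnd_simp// ltW.
have nbad_ge w : (~` E) w -> J%:R / 2 <= nbad w.
  move=> /negP; rewrite -leNgt => /(le_trans (obs_ge w)).
  by rewrite lee_fin => /le_lt_trans/(_ MJ); rewrite ltr_pM2l//; lra.
have nbad_ge0 w : 0 <= nbad w by apply: sumr_ge0.
have mbad j : measurable_fun setT (fun w => (\1_(bad j) w : R)%:E).
  by apply/measurable_EFinP; exact: measurable_indic.
have : (\int[P]_w ((J%:R / 2)%:E * (\1_(~` E) w)%:E) <= \int[P]_w (nbad w)%:E)%E.
  apply: ge0_le_integralT => w; first by rewrite mule_ge0// lee_fin// divr_ge0.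
  rewrite -EFinM lee_fin indicE; have [Ew|Ew] := pselect (E w).
    by rewrite memNset ?mulr0.
  by rewrite mem_set// mulr1 nbad_ge.
rewrite ge0_integralZl_EFin ?divr_ge0//; last first.
  by apply/measurable_EFinP; exact: measurable_indic.
rewrite integral_indic// setIT.
have -> : (\int[P]_w (nbad w)%:E = \sum_(0 <= j < J) P (bad j.+1))%E.
  under eq_integral do rewrite /nbad -sumEFin.
  rewrite ge0_integral_sum//.
  by apply: eq_bigr => j _; rewrite integral_indic// setIT.
move=> PE.
have {PE} : ((J%:R / 2)%:E * P (~` E) <= (2 * delta *+ J)%:E)%E.
  apply: le_trans PE _; rewrite -[X in _ *+ X]subn0 -sumr_const_nat -sumEFin.
  by apply: lee_sum => j _; exact: bad_le.
rewrite probability_setC// -(fineK (fin_num_measure P E mE)) -EFinB -EFinM !lee_fin.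
rewrite -mulr_natr => h.
have Jp : 0 < J%:R :> R by rewrite ltr0n.
suff : J%:R * (1 - 4 * delta) <= J%:R * fine (P E) by rewrite ler_pM2l.
by lra.
Qed.

End dyadic_scales.

(** * The power-law kernel and the limit *)

Lemma kernel_shape_subprobability (R : realType) (gamma : R) : 0 < gamma ->
  subprobability_kernel (kernel_shape gamma) (fun u => 1 - (1 + u) `^ (- gamma)).
Proof.
move=> gamma0.
have dp (a u : R) : 0 <= u -> is_derive u 1 (fun u => (1 + u) `^ a) (a * (1 + u) `^ (a - 1)).
  move=> u0.
  have d1 : is_derive u 1 (cst 1 + id) (0 + 1 : R) by exact: is_deriveD.
  have dpow : is_derive ((cst 1 + id) u) 1 (@powR R ^~ a) (a * (1 + u) `^ (a - 1)).
    by apply: is_derive1_powR; rewrite ltr_pwDl.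
  by apply: is_derive_eq (is_derive1_comp dpow d1) _; rewrite add0r mulr1.
have mp a : measurable_fun setT (fun u : R => (1 + u) `^ a).
  by apply: (measurableT_comp (measurable_powR a)); exact: measurable_funD.
split.
- by move=> u u0; rewrite mulr_ge0 ?powR_ge0// ltW.
- move=> u u0.
  have cp : {for u, continuous (fun u : R => (1 + u) `^ (- 1 - gamma))}.
    apply: differentiable_continuous; apply/derivable1_diffP.
    by have := dp (- 1 - gamma) u u0 => ?; exact: ex_derive.
  by apply: cvgMr; exact: cp.
- move=> u u0; rewrite (_ : kernel_shape gamma u = 0 - (- gamma * (1 + u) `^ (- gamma - 1))).
    by apply: is_deriveB; exact: (dp (- gamma)).
  by rewrite /kernel_shape sub0r mulNr opprK [- 1 - gamma]addrC.
- by rewrite addr0 powR1 subrr.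
- by move=> u u0; rewrite gerBl powR_ge0.
- exact: measurable_funM.
- exact: measurable_funB.
Qed.


Theorem corollary5p2 (R : realType) (lambdas mus gamma : R)
  (lambdas_gt0 : 0 < lambdas) (mus_gt0 : 0 < mus)
  (gamma_gt : 1 / 2 < gamma) (gamma_lt : gamma < 1)
  (d : R -> measure_display) (Omega : forall T : R, measurableType (d T))
  (P : forall T : R, probability (Omega T) R)
  (N : forall T : R, point_process (Omega T) R)
  (hawkesN : forall T : R, 0 < T ->
     0 < branching_ratio lambdas gamma T -> branching_ratio lambdas gamma T < 1 ->
     hawkes_process (P T) (baseline mus gamma T)
       (branching_ratio lambdas gamma T) (kernel_shape gamma) (N T)) :
  forall M : R,
    P T [set w | (M%:E < observed_information (baseline mus gamma T)
                    (branching_ratio lambdas gamma T) (kernel_shape gamma)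
                    (N T) T w)%E] @[T --> +oo%R] --> 1%E.
Proof.
move=> M; apply/fine_cvgP.
have gamma0 : 0 < gamma by lra.
have gG := kernel_shape_subprobability gamma0.
pose E T := [set w | (M%:E < observed_information (baseline mus gamma T)
  (branching_ratio lambdas gamma T) (kernel_shape gamma) (N T) T w)%E].
have eventually_large delta : 0 < delta -> delta <= 1 ->
    \forall T \near +oo, measurable (E T) /\ ((1 - 4 * delta)%:E <= P T (E T))%E.
  move=> d0 d1.
  pose J := (Num.truncn (M / (delta ^+ 2 / 20) * 2)).+1.
  have MJ : M < delta ^+ 2 / 20 * (J%:R / 2).
    have e0 : 0 < delta ^+ 2 / 20 by rewrite divr_gt0// exprn_gt0.
    rewrite -ltr_pdivrMl// mulrC ltr_pdivlMr//; exact: truncnS_gt.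
  (* T ^ gamma above A makes the branching ratio positive and leaves room for
     J scales before T *)
  pose A := Num.max (lambdas + 1) (2 ^+ J / mus).
  have A0 : 0 < A by rewrite lt_max addr_gt0.
  near=> T.
  have AT : A `^ gamma^-1 <= T by near: T; apply: nbhs_pinfty_ge; rewrite num_real.
  have T0 : 0 < T by apply: lt_le_trans AT; exact: powR_gt0.
  have {AT} AT : A <= T `^ gamma.
    rewrite -(powRr1 (ltW A0)) -(mulVf (lt0r_neq0 gamma0)) powRrM.
    by apply: ge0_ler_powR; rewrite ?nnegrE ?powR_ge0// ltW.
  have Tg0 : 0 < T `^ gamma by exact: powR_gt0.
  have lT : lambdas < T `^ gamma.
    by move: AT; rewrite ge_max => /andP[lA _]; apply: lt_le_trans lA; rewrite ltrDl.
  have rho0 : 0 < branching_ratio lambdas gamma T.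
    by rewrite /branching_ratio subr_gt0 powRN ltr_pdivrMr// mul1r.
  have rho1 : branching_ratio lambdas gamma T < 1.
    by rewrite /branching_ratio gtrBl mulr_gt0// powR_gt0.
  have mu0 : 0 < baseline mus gamma T by rewrite mulr_gt0// powR_gt0.
  have [F intensityN] := hawkesN T T0 rho0 rho1.
  apply: (information_large mu0 (ltW rho0) (ltW rho1) d0 d1 gG intensityN _ MJ) => //.
  rewrite /baseline -mulrA -{2}(powRr1 (ltW T0)) -powRD ?(gt_eqF T0) ?implybT// subrK.
  by move: AT; rewrite ge_max => /andP[_]; rewrite ler_pdivrMr// mulrC.
split.
  near=> T; have [mE _] : measurable (E T) /\ ((1 - 4 * 1)%:E <= P T (E T))%E.
    by near: T; exact: eventually_large.
  exact: fin_num_measure.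
apply/cvgrPdist_le => eps eps0.
pose delta := Num.min 1 (eps / 4).
have d0 : 0 < delta by rewrite lt_min ltr01 divr_gt0.
have d1 : delta <= 1 by rewrite ge_min lexx.
have d4 : 4 * delta <= eps.
  by rewrite mulrC -ler_pdivlMr// ge_min lexx orbT.
near=> T; have [mE] : measurable (E T) /\ ((1 - 4 * delta)%:E <= P T (E T))%E.
  by near: T; exact: eventually_large.
have := probability_le1 (P T) mE; rewrite /= -/(E T).
rewrite -(fineK (fin_num_measure (P T) _ mE)) !lee_fin => p1 pd.
by rewrite ger0_norm ?subr_ge0//; lra.
Unshelve. all: by end_near.
Qed.
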